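(* Let $n\ge 0$ be an integer. A $2\times(n+1)$ $\{0,1\}$-matrix is dope if and only if for each $k\in[0,n]$, there are at most $k$ nonzero entries in the last $k+1$ columns.
   Context: For a polynomial $P\in\mathbb{C}[x]$ of degree $n$ and an $m$-tuple $\Lambda=(\lambda_1,\dots,\lambda_m)$ of distinct complex numbers, the dope matrix of $P$ with respect to $\Lambda$ is the $m\times(n+1)$ matrix $D_P(\Lambda)=(\delta_{ij})_{i\in[1,m],\,j\in[0,n]}$, where $\delta_{ij}=1$ if $P^{(j)}(\lambda_i)=0$ and $\delta_{ij}=0$ otherwise ($P^{(j)}$ denotes the $j$-th derivative; columns are indexed $0,\dots,n$). A $\{0,1\}$-matrix is called dope if it equals $D_P(\Lambda)$ for some such $P$ and $\Lambda$. *)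

(* Defs.v *)
From HB Require Import structures.
From mathcomp Require Import all_boot all_order all_algebra.
From mathcomp Require Import reals complex.

Set Implicit Arguments.
Unset Strict Implicit.
Unset Printing Implicit Defensive.

Import GRing.Theory.
Local Open Scope ring_scope.

(* The complex numbers are R[i] for R : realType, and a {0,1}-matrix is a
   boolean matrix, true standing for the entry 1.  The matrix below is the
   dope matrix of P with respect to L when P has degree n and the entries
   of L are distinct; both conditions are imposed in is_dope. *)
Definition dope_mx (R : realType) (m n : nat) (P : {poly R[i]})
    (L : m.-tuple R[i]) : 'M[bool]_(m, n.+1) :=
  \matrix_(i < m, j < n.+1) (P^`(j).[tnth L i] == 0).

(* size P = n.+1 says that P is nonzero of degree exactly n. *)
Definition is_dope (R : realType) (m n : nat) (M : 'M[bool]_(m, n.+1)) : Prop :=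
  exists (P : {poly R[i]}) (L : m.-tuple R[i]),
    [/\ size P = n.+1, uniq L & M = dope_mx n P L].

(* The columns are indexed 0, ..., n, so for k <= n the last k + 1 columns
   are those with index at least n - k. *)
Definition nonzero_last (m n : nat) (M : 'M[bool]_(m, n.+1)) (k : nat) : nat :=
  #|[set ij : 'I_m * 'I_n.+1 | (n - k <= ij.2)%N && M ij.1 ij.2]|.

(* Main.v *)
Require Import Defs.
From HB Require Import structures.
From mathcomp Require Import all_boot all_order all_algebra.
From mathcomp Require Import reals complex polyrcf zify.

Set Implicit Arguments.
Unset Strict Implicit.
Unset Printing Implicit Defensive.

Import Order.TTheory GRing.Theory Num.Theory.
Local Open Scope ring_scope.

(** Necessity.  Let k be minimal such that the last k + 1 columns contain more
    than k ones, and let Q = P^(n - k), of degree k.  By minimality the zeros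
    of the derivatives of Q at the two points satisfy Polya's condition (for
    every r <= k, at least r + 1 of them concern orders at most r).  After an
    affine change of variable the two points are 0 and 1, and, for the real and
    imaginary parts of Q, Rolle's theorem shows that every derivative of order
    at most k vanishes somewhere in [0, 1]; hence Q = 0, a contradiction.

    Sufficiency.  Take the points 0 and 1.  If M has N ones, then N <= n; add
    to them the n - N conditions that P vanishes at given points of ]0, 1[.
    These n conditions have a nonzero solution P of degree at most n.  If P
    also satisfied the condition of a zero entry of M, the Rolle argument would
    give P = 0.  So every zero entry of M is avoided by some solution of the
    conditions of M, and a generic combination avoids all of them at once. *)

(** * Rolle's theorem and root counting over a real closed field *)

Section Rolle.
Variable R : rcfType.
Implicit Types (P : {poly R}) (s t : seq R).

Lemma deriv_interlacing_roots P x s :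
    path <%R x s -> root P x -> all (root P) s ->
  exists t, [/\ size t = size s, path <%R x t, all (< last x s) t
              & all (root P^`()) t].
Proof.
elim: s x => [|y s IHs] x /=; first by exists [::].
move=> /andP[xy ys] Px /andP[Py Ps].
have [t [st yt ts Pt]] := IHs y ys Py Ps.
have Pxy : P.[x] = P.[y] by rewrite (rootP Px) (rootP Py).
have [c] := poly_rolle xy Pxy.
rewrite in_itv /= => /andP[xc cy] Pc.
exists (c :: t); split => /=; first by rewrite st.
- by rewrite xc; case: t yt {st ts Pt} => //= z t /andP[yz ->]; rewrite (lt_trans cy).
- rewrite ts andbT (lt_le_trans cy) //.
  have := mem_last y s; rewrite inE => /predU1P[->//|ls].
  by have /allP/(_ _ ls)/ltW := order_path_min lt_trans ys.
- by rewrite Pt andbT; apply/rootP.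
Qed.

(** Sorting makes the roots distinct; 0 and 1 are left out because the conditions there are counted
    separately. *)
Definition interior_roots P s :=
  [/\ sorted <%R s, all (fun x : R => 0 < x < 1) s & all (root P) s].

(* Rolle's theorem, applied between consecutive roots in [0, 1], loses exactly
   one root; roots at the endpoints count, but only as simple ones. *)
Lemma interior_roots_deriv P s (a b : bool) :
    interior_roots P s -> (a -> P.[0] = 0) -> (b -> P.[1] = 0) ->
  exists2 t, interior_roots P^`() t & (size s + (a + b) <= (size t).+1)%N.
Proof.
move=> [ss s01 Ps] Pa Pb.
pose s' := [seq x <- [:: 0] | a] ++ s ++ [seq x <- [:: 1] | b].
have s'size : size s' = (size s + (a + b))%N.
  by rewrite /s' !size_cat; case: a {Pa s'}; case: b {Pb} => /=; lia.
have s'root : all (root P) s'.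
  rewrite /s' !all_cat Ps; case: a Pa {s' s'size} => [/(_ isT) Pa|_];
    case: b Pb => [/(_ isT) Pb|_] //=; rewrite ?andbT ?rootE ?Pa ?Pb ?eqxx //.
have s'sorted : sorted <%R s'.
  have := ss; rewrite !(sorted_pairwise lt_trans) /s' !pairwise_cat => ->.
  have h0 : allrel <%R [:: 0] s by rewrite allrel1l; apply: sub_all s01 => x /andP[].
  have h1 : allrel <%R s [:: 1] by rewrite allrel1r; apply: sub_all s01 => x /andP[].
  case: a {Pa s' s'size s'root}; case: b {Pb} => //=; rewrite ?allrel0l ?allrel0r ?h1 //=;
    rewrite ?cats0 ?h0 //.
  by rewrite allrel_catr h0 allrel1l /= ltr01.
have s'01 x : x \in s' -> 0 <= x <= 1.
  rewrite /s' !mem_cat => /or3P[|/(allP s01)/andP[/ltW-> /ltW->]//|].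
    by case: (a) => //=; rewrite inE => /eqP->; rewrite lexx ler01.
  by case: (b) => //=; rewrite inE => /eqP->; rewrite lexx ler01.
case: s' s'size s'root s'sorted s'01 => [|x s'] /= <-.
  by move=> *; exists [::].
move=> /andP[Px Ps'] xs' x01.
have [t [st xt ts Pt]] := deriv_interlacing_roots xs' Px Ps'.
exists t; last by rewrite st.
split => //; first exact: path_sorted xt.
apply/allP => z zt.
have /andP[x0 _] := x01 x (mem_head _ _).
have /andP[_ l1] := x01 _ (mem_last x s').
rewrite (le_lt_trans x0) ?(lt_le_trans (allP ts _ zt)) //.
exact: (allP (order_path_min lt_trans xt)).
Qed.

(** Each differentiation costs one root, after the prescribed zeros at 0 and 1 have been added; the
    [r] lost roots stand on the right to avoid truncated subtraction. *)
Lemma interior_roots_derivn P s (A B : nat -> bool) r :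
    interior_roots P s ->
    (forall j, A j -> P^`(j).[0] = 0) -> (forall j, B j -> P^`(j).[1] = 0) ->
  exists2 t, interior_roots P^`(r) t
           & (size s + \sum_(j < r) (A j + B j) <= size t + r)%N.
Proof.
move=> Ps PA PB; elim: r => [|r [t Pt lt]].
  by exists s; rewrite ?derivn0 // big_ord0.
have [t' Pt' lt'] := interior_roots_deriv Pt (PA r) (PB r).
exists t'; first by rewrite derivnS.
rewrite big_ord_recr /= addnA addnS -addSn.
by rewrite (leq_trans (leq_add lt (leqnn _))) // addnAC leq_add2r.
Qed.

(* Polya's condition forces every derivative of order at most n, in particular
   the one of order deg P, to vanish somewhere in [0, 1]. *)
Lemma polya_real P s (A B : nat -> bool) n :
    (size P <= n.+1)%N -> interior_roots P s ->
    (forall j, A j -> P^`(j).[0] = 0) -> (forall j, B j -> P^`(j).[1] = 0) ->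
    (forall k, (k <= n)%N -> (k < size s + \sum_(j < k.+1) (A j + B j))%N) ->
  P = 0.
Proof.
move=> szP Ps PA PB h; apply/eqP; apply: contraT => P0.
pose d := (size P).-1.
have dn : (d <= n)%N by rewrite /d; lia.
have [t Pt lt] := interior_roots_derivn d Ps PA PB.
have Pd : P^`(d) = (lead_coef P *+ d`!)%:P.
  apply/polyP => -[|i]; rewrite coef_derivn coefC /= ?addn0 ?ffactnn //.
  by rewrite nth_default ?mul0rn // addnS -addSn (leq_trans (leqSpred _)) ?leq_addr.
have Pd0 x : P^`(d).[x] != 0.
  rewrite Pd hornerC mulrn_eq0 negb_or lead_coef_eq0 P0 andbT.
  by rewrite -lt0n fact_gt0.
(* The derivative of order [d] is a nonzero constant, so [t] is empty and [A d], [B d] fail; then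
   [lt] contradicts the hypothesis at [k = d]. *)
have := h d dn; rewrite big_ord_recr /=.
case: Pt => _ _; case: t lt => [|z t] lt /=; last first.
  by move=> /andP[/rootP Pz]; have := Pd0 z; rewrite Pz eqxx.
case Ad: (A d); first by have := Pd0 0; rewrite PA ?eqxx.
case Bd: (B d); first by have := Pd0 1; rewrite PB ?eqxx.
by rewrite !addn0 ltnNge lt.
Qed.

End Rolle.

(** * Polya's condition for complex polynomials *)

Local Notation "x %:C" := (real_complex _ x) : ring_scope.

(** All the points are real, so each condition on [P] passes to the polynomials formed by the real
    and the imaginary parts of its coefficients. *)
Lemma polya_complex (R : rcfType) (P : {poly R[i]}) (s : seq R)
    (A B : nat -> bool) n :
    (size P <= n.+1)%N -> sorted <%R s -> all (fun x : R => 0 < x < 1) s ->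
    all (fun x => root P x%:C) s ->
    (forall j, A j -> P^`(j).[0] = 0) -> (forall j, B j -> P^`(j).[1] = 0) ->
    (forall k, (k <= n)%N -> (k < size s + \sum_(j < k.+1) (A j + B j))%N) ->
  P = 0.
Proof.
move=> szP ss s01 Ps PA PB h.
pose P1 := \poly_(i < size P) complex.Re P`_i.
pose P2 := \poly_(i < size P) complex.Im P`_i.
have PE : P = map_poly (real_complex R) P1 + 'i%C *: map_poly (real_complex R) P2.
  apply/polyP => i; rewrite coefD coefZ (coef_map (real_complex R) P1) (coef_map (real_complex R) P2) !coef_poly.
  case: ltnP => [_|iP]; first exact: complexE.
  by rewrite nth_default // mulr0 addr0.
have P12 j x : P^`(j).[x%:C] = 0 -> P1^`(j).[x] = 0 /\ P2^`(j).[x] = 0.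
  rewrite PE derivnD derivnZ !derivn_map hornerD hornerZ !horner_map /=.
  by move=> /eqP; rewrite eq_complex /= => /andP[/eqP + /eqP]; rewrite !(mul0r,mul1r,add0r,addr0,subr0,mulr0).
have szP1 : (size P1 <= n.+1)%N by apply: leq_trans (size_poly _ _) szP.
have szP2 : (size P2 <= n.+1)%N by apply: leq_trans (size_poly _ _) szP.
have Ps12 x : x \in s -> P1.[x] = 0 /\ P2.[x] = 0.
  by move=> /(allP Ps)/rootP/(P12 0).
rewrite PE (polya_real (s := s) (A := A) (B := B) szP1) //; last first.
- by move=> j /PB/(P12 j 1)[].
- by move=> j /PA/(P12 j 0)[].
- by split=> //; apply/allP => x /Ps12[/rootP].
rewrite (polya_real (s := s) (A := A) (B := B) szP2) //; last first.
- by move=> j /PB/(P12 j 1)[].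
- by move=> j /PA/(P12 j 0)[].
- by split=> //; apply/allP => x /Ps12[_ /rootP].
by rewrite !rmorph0 scaler0 addr0.
Qed.

Lemma derivn_comp_affine (F : comNzRingType) (P : {poly F}) (a c : F) j :
  (P \Po (c *: 'X + a%:P))^`(j) = c ^+ j *: (P^`(j) \Po (c *: 'X + a%:P)).
Proof.
elim: j => [|j IHj]; first by rewrite expr0 scale1r.
rewrite derivnS IHj derivZ deriv_comp -derivnS.
rewrite derivD derivZ derivX derivC addr0 -scalerAr mulr1 scalerA.
by rewrite -exprSr.
Qed.

(* Polya's theorem on two-point Birkhoff interpolation, in uniqueness form. *)
Lemma polya_two_points (R : rcfType) (P : {poly R[i]}) (a b : R[i])
    (A B : nat -> bool) n :
    a != b -> (size P <= n.+1)%N ->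
    (forall j, A j -> P^`(j).[a] = 0) -> (forall j, B j -> P^`(j).[b] = 0) ->
    (forall k, (k <= n)%N -> (k < \sum_(j < k.+1) (A j + B j))%N) ->
  P = 0.
Proof.
move=> ab szP PA PB h.
(* This affine map sends 0 to [a] and 1 to [b]. *)
pose q := (b - a) *: 'X + a%:P.
have ba : b - a != 0 by rewrite subr_eq0 eq_sym.
have szq : size q = 2.
  by rewrite /q size_polyDl size_scale ?size_polyX // (leq_ltn_trans (size_polyC_leq1 _)).
have Q0 : P \Po q = 0.
  apply: (polya_complex (s := [::]) (A := A) (B := B) (n := n)) => //.
  - by rewrite size_comp_poly2.
  - by move=> j /PA Pa; rewrite derivn_comp_affine !hornerE horner_comp !hornerE Pa mulr0.
  - by move=> j /PB Pb; rewrite derivn_comp_affine !hornerE horner_comp !hornerE subrK Pb mulr0.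
by apply/eqP; rewrite -size_poly_eq0 -(size_comp_poly2 P szq) Q0 size_poly0.
Qed.

(** * Linear conditions and generic combinations *)

(** There are fewer equations than the [n + 1] unknown coefficients. A condition is a point paired
    with an order of derivation. *)
Lemma interpolation_kernel (F : fieldType) n (cs : seq (F * nat)) :
    (size cs <= n)%N ->
  exists P : {poly F}, [/\ P != 0, (size P <= n.+1)%N
    & forall c, c \in cs -> P^`(c.2).[c.1] = 0].
Proof.
move=> szcs; pose c0 : F * nat := (0, 0%N).
pose A : 'M[F]_(n.+1, size cs) :=
  \matrix_(i, j) ('X^i)^`((nth c0 cs j).2).[(nth c0 cs j).1].
have kA : kermx A != 0.
  rewrite kermx_eq0 /row_free neq_ltn; apply/orP; left.
  by rewrite (leq_ltn_trans (rank_leq_col A)).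
have vA : nz_row (kermx A) *m A = 0 by apply/sub_kermxP/nz_row_sub.
have v0 : nz_row (kermx A) != 0 by rewrite nz_row_eq0.
move: (nz_row _) v0 vA => v v0 vA.
exists (rVpoly v); split.
- by apply: contra v0 => /eqP v0; rewrite -(rVpolyK v) v0 linear0.
- exact: size_poly.
move=> c /(nthP c0)[k kcs <-].
have /matrixP/(_ 0 (Ordinal kcs)) := vA; rewrite !mxE /= => vAk; rewrite -[RHS]vAk.
rewrite /rVpoly poly_def linear_sum horner_sum.
apply: eq_bigr => i _; rewrite insubT //= => lti.
rewrite linearZ hornerZ mxE; congr (v _ _ * _).
by apply: val_inj.
Qed.

Lemma notin_finite (F : numDomainType) (s : seq F) : exists t, t \notin s.
Proof.
have /allPn[t _ ts] : ~~ all (mem s) (mkseq (fun k => k%:R) (size s).+1).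
  apply/negP => /allP ss.
  have : uniq (mkseq (fun k => k%:R : F) (size s).+1).
    by apply: mkseq_uniq => i j /eqP; rewrite eqr_nat => /eqP.
  by move=> /uniq_leq_size/(_ ss); rewrite size_mkseq ltnn.
by exists t.
Qed.

(** A vector space over an infinite field is not a finite union of proper subspaces. *)
Lemma generic_nonvanishing (F : numFieldType) (V : {poly F} -> Prop)
    (cs : seq (F * nat)) :
    V 0 -> (forall t P Q, V P -> V Q -> V (P + t *: Q)) ->
    (forall c, c \in cs -> exists2 Q, V Q & Q^`(c.2).[c.1] != 0) ->
  exists2 P, V P & forall c, c \in cs -> P^`(c.2).[c.1] != 0.
Proof.
move=> V0 VD; elim: cs => [|c cs IHcs] h; first by exists 0.
have [|P VP Pcs] := IHcs; first by move=> d dcs; apply: h; rewrite inE dcs orbT.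
have [Q VQ Qc] := h c (mem_head _ _).
(* Each condition excludes at most one [t]; where the derivative of [Q] vanishes, division by zero
   merely excludes 0 as well. *)
have [t] := notin_finite [seq - P^`(d.2).[d.1] / Q^`(d.2).[d.1] | d <- c :: cs].
move=> tP; exists (P + t *: Q); first exact: VD.
move=> d dcs; rewrite derivnD derivnZ hornerD hornerZ.
have [Qd|Qd] := eqVneq Q^`(d.2).[d.1] 0.
  rewrite Qd mulr0 addr0; apply: Pcs; move: dcs; rewrite inE => /predU1P[dc|//].
  by rewrite -dc Qd eqxx in Qc.
apply: contra tP => /eqP tPQ; apply/mapP; exists d => //.
by apply: (canRL (mulfK Qd)); apply/eqP; rewrite -addr_eq0 addrC tPQ.
Qed.

(** * Counting ones by columns, and the two implications *)

Lemma nonzero_lastE n (M : 'M[bool]_(2, n.+1)) k :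
  nonzero_last M k =
  (\sum_(n - k <= j < n.+1) (M 0%R (inord j) + M 1%R (inord j)))%N.
Proof.
rewrite /nonzero_last -sum1_card big_geq_mkord /= big_mkcond /=.
under eq_bigr do rewrite inE.
rewrite -(pair_bigA _ (fun i j => if (n - k <= nat_of_ord j)%N && M i j then 1 else 0)%N) /=.
rewrite exchange_big /= [RHS]big_mkcond /=.
apply: eq_bigr => j _; rewrite big_ord_recl big_ord1 inord_val.
have -> : lift ord0 ord0 = 1 :> 'I_2 by apply: val_inj.
have -> : ord0 = 0 :> 'I_2 by apply: val_inj.
by case: leqP => //= _; case: (M 0 j); case: (M 1 j).
Qed.

Lemma interior_points (R : numFieldType) m :
  exists s : seq R, [/\ size s = m, sorted <%R s & all (fun x : R => 0 < x < 1) s].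
Proof.
exists [seq (k.+1%:R / m.+1%:R) | k <- iota 0 m]; split.
- by rewrite size_map size_iota.
- apply: (homo_sorted (e := ltn)); last exact: iota_ltn_sorted.
  by move=> i j ij; rewrite ltr_pM2r ?invr_gt0 ?ltr0n // ltr_nat.
- apply/allP => _ /mapP[k + ->]; rewrite mem_iota add0n => /= km.
  by rewrite divr_gt0 ?ltr0n //= ltr_pdivrMr ?ltr0n // mul1r ltr_nat.
Qed.

Lemma dope_nonzero_last (R : realType) n (M : 'M[bool]_(2, n.+1)) :
  is_dope R M -> forall k, (k <= n)%N -> (nonzero_last M k <= k)%N.
Proof.
move=> [P [L [szP uL ME]]] k kn; rewrite leqNgt; apply/negP => bad.
have ex : exists k, (k <= n)%N && (k < nonzero_last M k)%N by exists k; rewrite kn.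
have [{bad kn}k /andP[kn bad] kmin] := ex_minnP ex.
have Mzero (i : 'I_2) j : M i (inord j) && (j <= n)%N -> P^`(j).[tnth L i] = 0.
  by move=> /andP[+ jn]; rewrite ME mxE inordK // => /eqP.
have ab : tnth L 0 != tnth L 1.
  by rewrite !(tnth_nth 0) nth_uniq ?size_tuple.
pose Q := P^`(n - k).
have Qj j : Q^`(j) = P^`(n - k + j) by rewrite /Q /derivn addnC iterD.
(* The bound matters: beyond [n], [inord] falls back to column 0. *)
pose Z i j := M i (inord (n - k + j)) && (n - k + j <= n)%N.
suff Q0 : Q = 0.
  (* This coefficient is a nonzero multiple of the leading coefficient of [P]. *)
  have : Q`_k = 0 by rewrite Q0 coef0.
  rewrite coef_derivn subnK // => /eqP.
  have -> : n = (size P).-1 by rewrite szP.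
  rewrite -/(lead_coef P) mulrn_eq0 lead_coef_eq0 -size_poly_eq0 szP orbF.
  by rewrite -leqn0 leqNgt ffact_gt0 /= leq_subr.
apply: (polya_two_points (a := tnth L 0) (b := tnth L 1) (n := k)
  (A := Z 0) (B := Z 1)) => //.
- apply/leq_sizeP => j kj; rewrite coef_derivn nth_default ?mul0rn //.
  by rewrite szP; lia.
- by move=> j; rewrite Qj; apply: Mzero.
- by move=> j; rewrite Qj; apply: Mzero.
move=> r rk; rewrite -(big_mkord xpredT (fun j => Z 0%R j + Z 1%R j)%N).
pose e j := (M 0%R (inord j) + M 1%R (inord j))%N.
have -> : (\sum_(0 <= j < r.+1) (Z 0%R j + Z 1%R j) =
           \sum_(n - k <= j < n - k + r.+1) e j)%N.
  rewrite [RHS](_ : _ = \sum_(0 + (n - k) <= j < n - k + r.+1) e j)%N //.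
  rewrite big_addn addKn.
  apply: eq_big_nat => j jr; rewrite /Z /e (addnC j).
  have -> : (n - k + j <= n)%N by lia.
  by rewrite !andbT.
move: bad; rewrite nonzero_lastE -/e.
rewrite (big_cat_nat (n := n - k + r.+1)) ?leq_addr //=; last by lia.
move: rk; rewrite leq_eqVlt => /predU1P[->|rk].
  by rewrite addnS subnK // [X in (_ + X)%N]big_geq ?addn0.
(* By minimality the last [k - r] columns hold fewer than [k - r] ones, so more than [r] ones lie in
   the [r + 1] columns before them. *)
have rn : (k - r.+1 <= n)%N by lia.
have := contra (fun h => kmin (k - r.+1)%N h).
rewrite -ltnNge rn /= -leqNgt nonzero_lastE -/e.
have -> : (n - (k - r.+1) = n - k + r.+1)%N by lia.
have lt : (k - r.+1 < k)%N by lia.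
by move=> /(_ lt); move: (bigop _ _ _) (bigop _ _ _) => x y; lia.
Qed.

Lemma nonzero_last_dope (R : realType) n (M : 'M[bool]_(2, n.+1)) :
  (forall k, (k <= n)%N -> (nonzero_last M k <= k)%N) -> is_dope R M.
Proof.
move=> hM.
pose L : 2.-tuple R[i] := [tuple 0; 1].
pose V (P : {poly R[i]}) := (size P <= n.+1)%N /\
  forall i (j : 'I_n.+1), M i j -> P^`(j).[tnth L i] = 0.
pose ones := [seq (tnth L ij.1, nat_of_ord ij.2)
             | ij <- enum [set ij : 'I_2 * 'I_n.+1 | M ij.1 ij.2]].
pose zeros := [seq (tnth L ij.1, nat_of_ord ij.2)
              | ij <- enum [set ij : 'I_2 * 'I_n.+1 | ~~ M ij.1 ij.2]].
pose e j := (M 0%R (inord j) + M 1%R (inord j))%N.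
have szones : size ones = (\sum_(0 <= j < n.+1) e j)%N.
  have := nonzero_lastE M n; rewrite subnn => <-.
  rewrite size_map -cardE /nonzero_last subnn.
  by apply: eq_card => ij; rewrite !inE.
have [|||P [szP PM] PN] := @generic_nonvanishing _ V zeros.
- by split; rewrite ?size_poly0 // => i j _; rewrite raddf0 horner0.
- move=> t P Q [szP PM] [szQ QM]; split.
    by rewrite (leq_trans (size_polyD _ _)) // geq_max szP (leq_trans (size_scale_leq _ _)).
  by move=> i j Mij; rewrite derivnD derivnZ hornerD hornerZ PM ?QM // mulr0 addr0.
- move=> _ /mapP[[i0 j0] + ->]; rewrite mem_enum inE /= => Mij0.
  have szn : (size ones <= n)%N.
    by rewrite szones; have := hM n (leqnn n); rewrite nonzero_lastE subnn.
  have [s [szs ss s01]] := interior_points R (n - size ones).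
  have [|P [P0 szP Pcs]] := @interpolation_kernel _ n
      (ones ++ [seq (x%:C, 0%N) | x <- s]).
    by rewrite size_cat [X in (_ + X)%N]size_map szs subnKC.
  have PM i (j : 'I_n.+1) : M i j -> P^`(j).[tnth L i] = 0.
    move=> Mij; apply: (Pcs (tnth L i, nat_of_ord j)).
    by rewrite mem_cat; apply/orP; left; apply/mapP; exists (i, j); rewrite // mem_enum inE.
  exists P; first by [].
  apply: contra P0 => /eqP Pij0; apply/eqP.
  (* The ones of [M], together with the zero entry whose condition is assumed to hold. *)
  pose Z i j := (j <= n)%N && (M i (inord j) || ((i, inord j) == (i0, j0))).
  have PZ i j : Z i j -> P^`(j).[tnth L i] = 0.
    move=> /andP[jn]; rewrite -ltnS in jn.
    move=> /orP[/PM|/eqP[-> jj0]]; first by rewrite inordK.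
    by move: Pij0; rewrite -jj0 /= inordK.
  apply: (polya_complex (n := n) (s := s) (A := Z 0) (B := Z 1)) => //.
  - apply/allP => x xs; apply/rootP; apply: (Pcs (x%:C, 0%N)).
    by rewrite mem_cat; apply/orP; right; apply: map_f.
  - by move=> j /PZ.
  - by move=> j /PZ.
  move=> k kn; rewrite szs szones.
  move: szn; rewrite szones => szn.
  (* Let N be the number of ones. For [k < n] the last [n - k] columns hold at most [n - k - 1] of
     them, so the others and the [n - N] interior roots number at least [k + 1]. For [k = n] the
     total is only [n], and the extra entry supplies the missing one. *)
  move: kn; rewrite leq_eqVlt => /predU1P[->|kn]; last first.
    have ek : (\sum_(j < k.+1) (Z 0%R j + Z 1%R j) >= \sum_(0 <= j < k.+1) e j)%N.
      rewrite big_mkord; apply: leq_sum => j _; rewrite /e /Z.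
      have -> : (j <= n)%N by rewrite -ltnS (leq_trans (ltn_ord j)) // ltnS ltnW.
      by case: (M 0 _); case: (M 1 _) => //=; rewrite ?addn0 ?add0n ?leq_addr ?leq_addl.
    have := hM (n - k.+1)%N (leq_subr _ _).
    rewrite nonzero_lastE subKn // -/e.
    move: szn; rewrite (big_cat_nat (n := k.+1)) //=; last by lia.
    by move: ek; move: (bigop _ _ _) (bigop _ _ _) (bigop _ _ _) => x y z; lia.
  have eZ j : (j <= n)%N -> (Z 0%R j + Z 1%R j = e j + (inord j == j0))%N.
    move=> jn; rewrite /Z /e jn /= !xpair_eqE.
    have [jj0|_] := eqVneq (inord j) j0; last by rewrite !andbF !orbF addn0.
    rewrite jj0 !andbT.
    case: i0 Mij0 {Pij0 PZ Z} => -[|[|//]] lti.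
      have -> : Ordinal lti = 0 by apply: val_inj.
      by move=> /negbTE ->; rewrite orbF add0n addnC.
    have -> : Ordinal lti = 1 by apply: val_inj.
    by move=> /negbTE ->; rewrite orbF addn0.
  have -> : (\sum_(j < n.+1) (Z 0%R j + Z 1%R j) =
             (\sum_(0 <= j < n.+1) e j).+1)%N.
    rewrite (eq_bigr (fun j : 'I_n.+1 => e j + (j == j0))%N); last first.
      by move=> j _; rewrite eZ ?inord_val // -ltnS.
    rewrite big_split /= big_mkord -[RHS]addn1; congr (_ + _)%N.
    by rewrite (bigD1 j0) //= eqxx big1 // => j /negbTE->.
  by rewrite addnS ltnS addnC subnKC.
have zerosP (i : 'I_2) (j : 'I_n.+1) : ~~ M i j -> P^`(j).[tnth L i] != 0.
  move=> Mij; apply: (PN (tnth L i, nat_of_ord j)).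
  by apply/mapP; exists (i, j); rewrite // mem_enum inE.
exists P, L; split.
(* The hypothesis at [k = 0] says that the last column is zero, so the derivative of order [n]
   cannot vanish and the degree is exactly [n]. *)
- apply/eqP; rewrite eqn_leq szP ltnNge; apply/negP => /derivn_poly0 Pn.
  have := zerosP 0 ord_max; rewrite Pn horner0 eqxx => Mn.
  have := hM 0%N (leq0n _); rewrite nonzero_lastE subn0 big_nat1.
  rewrite (_ : inord n = ord_max); last by apply: val_inj; rewrite /= inordK.
  by case: (M 0 ord_max) Mn => // /(_ isT).
- by rewrite /= inE eq_sym oner_eq0.
- apply/matrixP => i j; rewrite mxE.
  case Mij: (M i j); first by rewrite PM ?eqxx.
  by rewrite (negbTE (zerosP _ _ _)) ?Mij.
Qed.

Theorem theorem1p1 (R : realType) (n : nat) (M : 'M[bool]_(2, n.+1)) :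
  is_dope R M <-> (forall k : nat, (k <= n)%N -> (nonzero_last M k <= k)%N).
Proof. by split; [exact: dope_nonzero_last | exact: nonzero_last_dope]. Qed.
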